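(* Let $n, m \ge 2$ and $k \ge 1$ be integers. (i) Let $S_1, S_2 \subseteq \mathbb{R}$ with $|S_1| = n$, $|S_2| = m$ and $0 \in S_1 \cap S_2$, and suppose the grid $\Gamma = S_1 \times S_2 \subseteq \mathbb{R}^2$ is generic. Then \[ \operatorname{cov}_k(\Gamma) \ge k(n-1) + \frac{k}{n+m-2}(m-1)^2. \] (ii) Furthermore, if $\Gamma = S_1 \times S_2 \subseteq \mathbb{R}^2$ is an arbitrary $n \times m$ grid (that is, $|S_1| = n$, $|S_2| = m$, $0 \in S_1 \cap S_2$), and if $k$ is divisible by $\frac{n+m-2}{\gcd(n-1,m-1)}$, then \[ \operatorname{cov}_k(\Gamma) \le k(n-1) + \frac{k}{n+m-2}(m-1)^2. \] In particular, if in (ii) $\Gamma$ is generic, then equality holds.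
   Context: For finite $S_1, S_2 \subseteq \mathbb{R}$ with $0 \in S_1 \cap S_2$, let $\Gamma = S_1 \times S_2$. For an integer $k \ge 1$, a $k$-cover of $\Gamma$ is a finite multiset $\mathcal{H}$ of (affine) lines in $\mathbb{R}^2$ such that every point of $\Gamma \setminus \{(0,0)\}$ is contained in at least $k$ of the lines (counted with multiplicity), while no line of $\mathcal{H}$ contains $(0,0)$. $\operatorname{cov}_k(\Gamma)$ denotes the minimum cardinality (counted with multiplicity) of a $k$-cover of $\Gamma$. A point of $\Gamma$ is a boundary point if at least one of its coordinates equals $0$, and an interior point otherwise. $\Gamma$ is called generic if every line containing two (distinct) boundary points of $\Gamma$ contains no interior point of $\Gamma$. *)

(* Defs.v *)
From mathcomp Require Import all_boot all_order all_algebra.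
From mathcomp Require Import finmap multiset.
From mathcomp Require Import boolp classical_sets reals.
Set Implicit Arguments.
Unset Strict Implicit.
Unset Printing Implicit Defensive.
Import Order.TTheory GRing.Theory Num.Theory.
Local Open Scope classical_set_scope.
Local Open Scope fset_scope.
Local Open Scope mset_scope.
Local Open Scope ring_scope.

Definition is_line (R : realType) (L : set (R * R)) : Prop :=
  exists a b c : R, (a, b) != (0, 0) /\
    L = [set p : R * R | a * p.1 + b * p.2 = c].

(* A multiset coerces to a sequence that repeats each element according to its
   multiplicity, so [count] and [size] take multiplicities into account. *)
Definition is_cover (R : realType) (k : nat) (G : {fset R * R})
    (H : {mset set (R * R)}) : Prop :=
  [/\ forall L, L \in H -> is_line L,
      forall L, L \in H -> ~ L (0, 0) &
      forall p, p \in G -> p != (0, 0) ->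
        (k <= count (fun L : set (R * R) => p \in L) H)%N].

Definition has_cover_of_size (R : realType) (k : nat) (G : {fset R * R})
    (c : nat) : bool :=
  `[< exists H : {mset set (R * R)}, is_cover k G H /\ size H = c >].

(* Take, for each point p of G other than the origin, k copies of the line
   through p orthogonal to p. *)
Lemma ex_has_cover_of_size (R : realType) (k : nat) (G : {fset R * R}) :
  exists c, has_cover_of_size k G c.
Proof.
pose l (p : R * R) : set (R * R) :=
  [set q : R * R | p.1 * q.1 + p.2 * q.2 = p.1 ^+ 2 + p.2 ^+ 2].
pose s := flatten [seq nseq k (l p) | p <- enum_fset G & p != (0, 0)].
have Hs L : L \in seq_mset s -> exists2 p, p != (0, 0) & L = l p.
  rewrite (perm_mem (perm_eq_seq_mset s)) => /flattenP[t].
  case/mapP=> p; rewrite mem_filter => /andP[p0 _] ->.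
  by rewrite mem_nseq => /andP[_ /eqP ->]; exists p.
exists (size (seq_mset s)); apply/asboolP; exists (seq_mset s); split=> //; split.
- move=> L /Hs[[a b] p0 ->]; exists a, b, (a ^+ 2 + b ^+ 2); split=> //.
- move=> L /Hs[[a b] p0 ->]; rewrite /l /= !mulr0 addr0 => /esym/eqP.
  rewrite paddr_eq0 ?sqr_ge0// !sqrf_eq0 => /andP[/eqP a0 /eqP b0].
  by move: p0; rewrite a0 b0 eqxx.
- move=> p pG p0; rewrite (permP (perm_eq_seq_mset s)) /s.
  have : p \in [seq p <- enum_fset G | p != (0, 0)] by rewrite mem_filter p0.
  elim: [seq p <- enum_fset G | p != (0, 0)] => //= q r IH.
  rewrite inE count_cat => /orP[/eqP <-|/IH]; last first.
    by move/leq_trans; apply; rewrite leq_addl.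
  by rewrite count_nseq [p \in l p]asboolT ?mul1n ?leq_addr.
Qed.

Definition cov (R : realType) (k : nat) (G : {fset R * R}) : nat :=
  ex_minn (ex_has_cover_of_size k G).

Definition boundary (R : realType) (p : R * R) : bool :=
  (p.1 == 0) || (p.2 == 0).

Definition generic (R : realType) (G : {fset R * R}) : Prop :=
  forall L : set (R * R), is_line L ->
    (exists p q, [/\ p \in G, q \in G, p != q, boundary p & boundary q] /\
                 L p /\ L q) ->
    forall r, r \in G -> ~~ boundary r -> ~ L r.

(* Main.v *)
Require Import Defs.
From mathcomp Require Import all_boot all_order all_algebra.
From mathcomp Require Import finmap multiset.
From mathcomp Require Import boolp classical_sets reals.
From mathcomp Require Import ring zify.
Set Implicit Arguments.
Unset Strict Implicit.
Unset Printing Implicit Defensive.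
Import Order.TTheory GRing.Theory Num.Theory.
Local Open Scope fset_scope.
Local Open Scope ring_scope.

(** Put a = n - 1 and b = m - 1; the claimed value is k (a^2 + ab + b^2) / (a + b).

    Both bounds come from one linear program and its dual.  For the lower bound,
    give each nonzero point of the grid on the first axis the weight a, each one
    on the second axis the weight b, and each interior point the weight 1.  The
    total weight is a^2 + b^2 + ab, and in a generic grid every line avoiding
    the origin carries weight at most a + b ([line_weight_le]).  Indeed, a line
    meeting both axes in grid points has no interior point; one meeting only the
    first axis has weight a there and is not horizontal, so it has at most one
    interior point in each of the b rows; the second axis is symmetric; and a
    line meeting neither has at most max(a, b) interior points.  Double counting
    the incidences between a k-cover H and the weighted points gives
    k (a^2 + ab + b^2) <= (a + b) |H| ([cover_size_ge]).

    For the upper bound, complementary slackness tells which lines to use: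
    vertical lines, horizontal lines and lines joining the two axes.  Let
    v = ka / (a + b) and h = kb / (a + b), which are integers under the
    divisibility hypothesis.  Take every vertical line v times and every
    horizontal line h times; since v + h = k the interior is covered.  A point of
    the first axis still misses h lines and one of the second axis misses v, so
    what remains is a bipartite multigraph with degrees h and v on the two sides,
    which exists because a h = b v: its j-th edge, for j < a h, joins the points
    numbered j mod a and j mod b ([ex_cover_of_degrees]). *)

(** * Counting *)

Lemma count_le1 (T : eqType) (P : pred T) (s : seq T) :
  uniq s -> {in s &, forall x y, P x -> P y -> x = y} -> (count P s <= 1)%N.
Proof.
move=> us inj; rewrite leqNgt -size_filter; apply/negP.
have : uniq [seq x <- s | P x] by rewrite filter_uniq.
case E: [seq x <- s | P x] => [|x [|y t]] //= /andP[xy _] _.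
have mem z : z \in [:: x, y & t] -> P z /\ z \in s.
  by rewrite -E mem_filter => /andP[].
have [[Px xs] [Py ys]] : (P x /\ x \in s) /\ (P y /\ y \in s).
  by split; apply: mem; rewrite !inE eqxx ?orbT.
by move: xy; rewrite (inj x y) // mem_head.
Qed.

Lemma leq_sum_seq_const (T : eqType) (s : seq T) (F : T -> nat) c :
  (forall x, x \in s -> F x <= c)%N -> (\sum_(x <- s) F x <= size s * c)%N.
Proof.
elim: s => [|x s IH] le; first by rewrite big_nil.
rewrite big_cons mulSn leq_add ?le ?mem_head // IH // => y ys.
by rewrite le // inE ys orbT.
Qed.

Lemma geq_sum_seq_const (T : eqType) (s : seq T) (F : T -> nat) c :
  (forall x, x \in s -> c <= F x)%N -> (size s * c <= \sum_(x <- s) F x)%N.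
Proof.
elim: s => [|x s IH] le; first by rewrite big_nil.
rewrite big_cons mulSn leq_add ?le ?mem_head // IH // => y ys.
by rewrite le // inE ys orbT.
Qed.

Lemma exchange_count (T U : Type) (r : T -> U -> bool) (s : seq T) (t : seq U) :
  (\sum_(x <- s) count (r x) t = \sum_(y <- t) count (r^~ y) s)%N.
Proof.
under eq_bigr do rewrite -sum1_count big_mkcond.
rewrite exchange_big; apply: eq_bigr => y _.
by rewrite -sum1_count [RHS]big_mkcond.
Qed.

Lemma count_flatten_nseq (T U : eqType) (P : pred U) (f : T -> U) v s x :
  x \in s -> P (f x) -> (v <= count P (flatten [seq nseq v (f y) | y <- s]))%N.
Proof.
move=> xs Pfx; elim: s xs => //= y s IH.
rewrite inE count_cat => /orP[/eqP <-|/IH]; last first.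
  by move/leq_trans; apply; exact: leq_addl.
by rewrite count_nseq Pfx mul1n leq_addr.
Qed.

Lemma size_flatten_nseq (T U : Type) (f : T -> U) v s :
  size (flatten [seq nseq v (f y) | y <- s]) = (v * size s)%N.
Proof. by elim: s => [|y s IH] /=; rewrite ?muln0 // size_cat size_nseq IH mulnS. Qed.

Lemma count_modn_iota a h i : (i < a)%N ->
  count (fun j => j %% a == i)%N (iota 0 (h * a)) = h.
Proof.
move=> ia; elim: h => [|h IH]; first by rewrite mul0n.
rewrite mulSn addnC iotaD count_cat IH add0n -[in iota (h * a) a](addn0 (h * a)%N).
rewrite iotaDl count_map.
suff -> : count (preim (addn (h * a)) (fun j => j %% a == i)%N) (iota 0 a) = 1%N.
  by rewrite addn1.
transitivity (count_mem i (iota 0 a)); last first.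
  by rewrite count_uniq_mem ?iota_uniq // mem_iota ia.
apply: eq_in_count => j; rewrite mem_iota /= add0n => ja.
by rewrite modnMDl modn_small.
Qed.

(** * The lower bound *)

(** Dual feasibility of the weights, [xs] and [ys] being the nonzero coordinates
    of the grid; the last hypothesis is genericity for the line
    alpha x + beta y = c.  In every case one of the three terms vanishes and the
    other two are bounded by [size xs] and [size ys]. *)
Lemma line_weight_le (F : fieldType) (xs ys : seq F) (alpha beta c : F) :
  uniq xs -> uniq ys -> (alpha, beta) != (0, 0) -> c != 0 ->
  (forall x y, x \in xs -> y \in ys -> alpha * x = c -> beta * y = c ->
     forall x' y', x' \in xs -> y' \in ys -> alpha * x' + beta * y' != c) ->
  (size xs * count (fun x => alpha * x == c)%R xs
   + size ys * count (fun y => beta * y == c)%R ys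
   + \sum_(x <- xs) count (fun y => alpha * x + beta * y == c)%R ys
   <= size xs + size ys)%N.
Proof.
move=> uxs uys ab0 c0 gen.
set X := count _ xs; set Y := count _ ys; set Z := (\sum_(x <- xs) _)%N.
have X1 : (X <= 1)%N.
  apply: count_le1 => // x y _ _ /eqP ex /eqP ey.
  have a0 : alpha != 0 by apply: contraNneq c0 => a0; rewrite -ex a0 mul0r.
  by apply: (mulfI a0); rewrite ex ey.
have Y1 : (Y <= 1)%N.
  apply: count_le1 => // x y _ _ /eqP ex /eqP ey.
  have b0 : beta != 0 by apply: contraNneq c0 => b0; rewrite -ex b0 mul0r.
  by apply: (mulfI b0); rewrite ex ey.
have Zx : beta != 0 -> (Z <= size xs)%N.
  move=> b0; rewrite -[size xs]muln1; apply: leq_sum_seq_const => x _.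
  apply: count_le1 => // y y' _ _ /eqP ey /eqP ey'.
  by apply: (mulfI b0); apply: (addrI (alpha * x)); rewrite ey ey'.
have Zy : alpha != 0 -> (Z <= size ys)%N.
  move=> a0; rewrite /Z exchange_count -[size ys]muln1.
  apply: leq_sum_seq_const => y _.
  apply: count_le1 => // x x' _ _ /eqP ex /eqP ex'.
  by apply: (mulfI a0); apply: (addIr (beta * y)); rewrite ex ex'.
have [/hasP[x xxs /eqP ex]|] := boolP (has (fun x => alpha * x == c) xs).
  have a0 : alpha != 0 by apply: contraNneq c0 => a0; rewrite -ex a0 mul0r.
  have [/hasP[y yys /eqP ey]|] := boolP (has (fun y => beta * y == c) ys).
    have -> : Z = 0%N.
      apply/eqP; rewrite -leqn0 -(muln0 (size xs)).
      apply: leq_sum_seq_const => x' x'xs.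
      rewrite leqn0 -[_ == _]negbK -lt0n -has_count -all_predC.
      by apply/allP => y' y'ys; exact: (gen x y).
    by rewrite addn0 leq_add // -[leqRHS]muln1 leq_mul2l ?X1 ?Y1 orbT.
  rewrite has_count -leqNgt leqn0 => /eqP; rewrite -/Y => ->.
  by rewrite muln0 addn0 leq_add ?Zy // -[leqRHS]muln1 leq_mul2l X1 orbT.
rewrite has_count -leqNgt leqn0 => /eqP; rewrite -/X => ->.
rewrite muln0 add0n.
(* No point of [xs] is on the line: only a vertical line needs [Zy]. *)
have [b0|b0] := eqVneq beta 0; last first.
  by rewrite addnC leq_add ?Zx // -[leqRHS]muln1 leq_mul2l Y1 orbT.
have a0 : alpha != 0 by apply: contraNneq ab0 => ->; rewrite b0.
have -> : Y = 0%N.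
  apply/eqP; rewrite -leqn0 leqNgt -has_count; apply/hasPn => y _.
  by rewrite b0 mul0r eq_sym.
by rewrite muln0 add0n (leq_trans (Zy a0)) ?leq_addl.
Qed.

(** Weak duality: the weighted incidences between points and lines are at least
    k times the total weight of the points, and at most a + b for each line. *)
Lemma cover_size_ge (R : realType) (k : nat) (S1 S2 : {fset R})
    (H : {mset set (R * R)}%mset) (a := #|` S1 `\ 0|) (b := #|` S2 `\ 0|) :
  0 \in S1 -> 0 \in S2 -> generic (S1 `*` S2) -> is_cover k (S1 `*` S2) H ->
  (k * (a * a + a * b + b * b) <= (a + b) * size H)%N.
Proof.
move=> z1 z2 gen [lineH nz0 cov].
pose xs : seq R := S1 `\ 0; pose ys : seq R := S2 `\ 0.
have xsP x : x \in xs -> x != 0 /\ x \in S1 by rewrite in_fsetD1 => /andP.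
have ysP y : y \in ys -> y != 0 /\ y \in S2 by rewrite in_fsetD1 => /andP.
pose W (L : set (R * R)) := (a * count (fun x => (x, 0%R) \in L) xs
  + b * count (fun y => (0%R, y) \in L) ys
  + \sum_(x <- xs) count (fun y => (x, y) \in L) ys)%N.
have Wle L : L \in H -> (W L <= a + b)%N.
  move=> LH; have [al [be [c [ab0 eL]]]] := lineH L LH.
  have memL p : (p \in L) = (al * p.1 + be * p.2 == c).
    by rewrite eL; apply/idP/eqP => [/set_mem|/mem_set].
  have LP p : al * p.1 + be * p.2 = c -> L p by rewrite eL.
  have -> : W L = (a * count (fun x => al * x == c)%R xs
      + b * count (fun y => be * y == c)%R ys
      + \sum_(x <- xs) count (fun y => al * x + be * y == c)%R ys)%N.
    congr (_ * _ + _ * _ + _)%N.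
    - by apply: eq_count => x; rewrite memL /= mulr0 addr0.
    - by apply: eq_count => y; rewrite memL /= mulr0 add0r.
    - by apply: eq_bigr => x _; apply: eq_count => y; rewrite memL.
  apply: line_weight_le => //; try exact: fset_uniq.
    apply/eqP => c0; apply: (nz0 L LH); apply: LP.
    by rewrite /= c0 !mulr0 addr0.
  move=> x y /xsP[x0 x1] /ysP[y0 y2] ex ey x' y' /xsP[x'0 x'1] /ysP[y'0 y'2].
  apply/eqP => /(LP (x', y')); apply: (gen L (lineH L LH)); last 2 first.
  - by rewrite in_fsetM /= x'1.
  - by rewrite /boundary /= negb_or x'0.
  exists (x, 0), (0, y); split; first split.
  - by rewrite in_fsetM /= x1.
  - by rewrite in_fsetM /= z1.
  - by rewrite xpair_eqE negb_and x0.
  - by rewrite /boundary /= eqxx orbT.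
  - by rewrite /boundary /= eqxx.
  - by split; apply: LP; rewrite /= mulr0 ?addr0 ?add0r.
have Hx x : x \in xs -> (k <= count (fun L : set (R * R) => (x, 0%R) \in L) H)%N.
  move=> /xsP[x0 x1]; apply: cov; first by rewrite in_fsetM /= x1.
  by rewrite xpair_eqE negb_and x0.
have Hy y : y \in ys -> (k <= count (fun L : set (R * R) => (0%R, y) \in L) H)%N.
  move=> /ysP[y0 y1]; apply: cov; first by rewrite in_fsetM /= z1.
  by rewrite xpair_eqE negb_and y0 orbT.
have Hxy x y : x \in xs -> y \in ys ->
    (k <= count (fun L : set (R * R) => (x, y) \in L) H)%N.
  move=> /xsP[x0 x1] /ysP[y0 y1]; apply: cov; first by rewrite in_fsetM /= x1.
  by rewrite xpair_eqE negb_and x0.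
rewrite mulnC [leqRHS]mulnC.
apply: (@leq_trans (\sum_(L <- H) W L)); last exact: leq_sum_seq_const.
have -> : (\sum_(L <- H) W L
    = a * \sum_(x <- xs) count (fun L : set (R * R) => (x, 0%R) \in L) H
      + b * \sum_(y <- ys) count (fun L : set (R * R) => (0%R, y) \in L) H
      + \sum_(x <- xs) \sum_(y <- ys)
          count (fun L : set (R * R) => (x, y) \in L) H)%N.
  rewrite !big_split -!big_distrr /=; congr (_ * _ + _ * _ + _)%N.
  - exact: exchange_count.
  - exact: exchange_count.
  - by rewrite exchange_big; apply: eq_bigr => x _; exact: exchange_count.
rewrite !mulnDl addnAC -!mulnA.
rewrite !leq_add ?leq_mul2l ?geq_sum_seq_const ?orbT //.
by move=> x xin; apply: geq_sum_seq_const => y yin; exact: Hxy.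
Qed.

(** * The upper bound *)

(** The [a * h] slanted lines are the edges of a bipartite multigraph between
    the two axes.  Reducing [j < a * h] modulo [a] and modulo [b] hits every
    residue equally often, [h] times and [v] times, because [a * h = b * v] is a
    multiple of both [a] and [b]. *)
Lemma ex_cover_of_degrees (R : realType) (k v h : nat) (S1 S2 : {fset R})
    (a := #|` S1 `\ 0|) (b := #|` S2 `\ 0|) :
  (v + h = k)%N -> (a * h = b * v)%N ->
  exists2 H : {mset set (R * R)}%mset,
    is_cover k (S1 `*` S2) H & size H = (v * a + h * b + a * h)%N.
Proof.
move=> vh ahbv.
pose xs : seq R := S1 `\ 0; pose ys : seq R := S2 `\ 0.
pose line (al be c : R) : set (R * R) := [set p | al * p.1 + be * p.2 = c]%classic.
(* [line y x (x * y)] joins (x, 0) to (0, y). *)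
pose e j := let x := nth 0 xs (j %% a) in let y := nth 0 ys (j %% b) in
  line y x (x * y).
pose s := flatten [seq nseq v (line 1 0 x) | x <- xs]
  ++ flatten [seq nseq h (line 0 1 y) | y <- ys] ++ [seq e j | j <- iota 0 (a * h)].
have xs0 x : x \in xs -> x != 0 by rewrite in_fsetD1 => /andP[].
have ys0 y : y \in ys -> y != 0 by rewrite in_fsetD1 => /andP[].
have sP L : L \in s -> exists al be c, [/\ (al, be) != (0, 0), c != 0 & L = line al be c].
  rewrite !mem_cat => /or3P[/flattenP[t /mapP[x /xs0 x0 ->]]|
      /flattenP[t /mapP[y /ys0 y0 ->]]|/mapP[j jlt ->]].
  - rewrite mem_nseq => /andP[_ /eqP ->]; exists 1, 0, x; split=> //.
    by rewrite xpair_eqE oner_eq0.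
  - rewrite mem_nseq => /andP[_ /eqP ->]; exists 0, 1, y; split=> //.
    by rewrite xpair_eqE oner_eq0 andbF.
  (* The range of [j] is empty when [a] or [b] is 0. *)
  have /andP[a0 b0] : (0 < a)%N && (0 < b)%N.
    move: jlt; rewrite mem_iota add0n => /andP[_ jlt].
    by have := jlt; rewrite {1}ahbv; case: (a) (b) jlt => [|?] [|?] //; lia.
  have x0 := xs0 _ (mem_nth 0 (ltn_pmod j a0 : _ < size xs)%N).
  have y0 := ys0 _ (mem_nth 0 (ltn_pmod j b0 : _ < size ys)%N).
  eexists _, _, _; split; last reflexivity; last by rewrite mulf_neq0.
  by rewrite xpair_eqE negb_and y0.
have memH L : (L \in seq_mset s) = (L \in s) by rewrite (perm_mem (perm_eq_seq_mset s)).
have Lin al be c p : al * p.1 + be * p.2 = c -> p \in line al be c by move=> ?; exact/mem_set.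
exists (seq_mset s); last first.
  rewrite (perm_size (perm_eq_seq_mset s)) !size_cat !size_flatten_nseq.
  by rewrite size_map size_iota addnA.
split=> [L|L|[x y]].
- by rewrite memH => /sP[al [be [c [ab0 _ ->]]]]; exists al, be, c.
- rewrite memH => /sP[al [be [c [_ c0 ->]]]]; rewrite /line /= !mulr0 addr0.
  by move=> /esym/eqP; apply/negP.
rewrite in_fsetM /= => /andP[x1 y1]; rewrite xpair_eqE negb_and => xy0.
rewrite (permP (perm_eq_seq_mset s)) !count_cat.
have Cv : x != 0 -> (v <= count (fun L : set (R * R) => (x, y) \in L)
    (flatten [seq nseq v (line 1%R 0%R x) | x <- xs]))%N.
  move=> x0; apply: (@count_flatten_nseq _ _ _ (line 1 0) v xs x).
    by rewrite in_fsetD1 x0.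
  by apply: Lin; rewrite /= mul1r mul0r addr0.
have Ch : y != 0 -> (h <= count (fun L : set (R * R) => (x, y) \in L)
    (flatten [seq nseq h (line 0%R 1%R y) | y <- ys]))%N.
  move=> y0; apply: (@count_flatten_nseq _ _ _ (line 0 1) h ys y).
    by rewrite in_fsetD1 y0.
  by apply: Lin; rewrite /= mul1r mul0r add0r.
have [x0|x0] := eqVneq x 0.
  have y0 : y != 0 by move: xy0; rewrite x0 eqxx.
  have yys : y \in ys by rewrite in_fsetD1 y0.
  rewrite (leq_trans _ (leq_addl _ _)) // -vh addnC leq_add ?Ch //.
  have iy : (index y ys < b)%N by rewrite index_mem.
  rewrite -{1}(count_modn_iota v iy) count_map ahbv mulnC; apply: sub_count => j /= /eqP jy.
  by apply: Lin; rewrite /= jy nth_index // x0 mulr0 add0r.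
have xxs : x \in xs by rewrite in_fsetD1 x0.
have [y0|y0] := eqVneq y 0; last first.
  by rewrite addnA (leq_trans _ (leq_addr _ _)) // -vh leq_add ?Cv ?Ch.
rewrite -vh leq_add ?Cv // (leq_trans _ (leq_addl _ _)) //.
have ix : (index x xs < a)%N by rewrite index_mem.
rewrite -{1}(count_modn_iota h ix) count_map mulnC; apply: sub_count => j /= /eqP jx.
by apply: Lin; rewrite /= jx nth_index // y0 mulr0 addr0 mulrC.
Qed.

(** The quotient of [a + b] by [gcdn a b] is the reduced denominator of both
    a / (a + b) and b / (a + b), so [k] splits integrally in the ratio a : b. *)
Lemma split_proportionally (a b k : nat) : (0 < a)%N ->
  ((a + b) %/ gcdn a b %| k)%N ->
  exists v h, [/\ v + h = k, a * h = b * v & v * (a + b) = k * a]%N.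
Proof.
move=> a0 dvk; have ab0 : (0 < a + b)%N by rewrite addn_gt0 a0.
have dab : (gcdn a b %| a + b)%N by rewrite dvdn_add ?dvdn_gcdl ?dvdn_gcdr.
have /dvdnP[v ev] : (a + b %| k * a)%N.
  by rewrite -(divnK dab) dvdn_mul // dvdn_gcdl.
have vk : (v <= k)%N by rewrite -(leq_pmul2r ab0) -ev leq_mul2l leq_addr orbT.
exists v, (k - v)%N; rewrite subnKC //; split=> //.
by rewrite mulnBr (mulnC a k) ev mulnDr (mulnC v a) addKn mulnC.
Qed.

(** * The value of the covering number *)

Lemma ex_min_cover (R : realType) (k : nat) (G : {fset R * R}) :
  exists2 H : {mset set (R * R)}%mset, is_cover k G H & size H = cov k G.
Proof. by rewrite /cov; case: ex_minnP => c /asboolP[H [? ?]] _; exists H. Qed.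

Lemma cov_le (R : realType) (k : nat) (G : {fset R * R}) (H : {mset set (R * R)}%mset) :
  is_cover k G H -> (cov k G <= size H)%N.
Proof.
by move=> covH; rewrite /cov; case: ex_minnP => c _; apply; apply/asboolP; exists H.
Qed.

(** A form of the bound that is symmetric in the two sides of the grid and has a
    single denominator, so that comparing it with an integer is a statement on
    natural numbers. *)
Lemma bound_eq (R : realType) (a b k : nat) : (0 < a)%N ->
  k%:R * (a.+1%:R - 1) + k%:R / (a.+1%:R + b.+1%:R - 2) * (b.+1%:R - 1) ^+ 2
  = (k * (a * a + a * b + b * b))%:R / (a + b)%:R :> R.
Proof.
move=> a0; have ab : (a + b)%:R != 0 :> R by rewrite pnatr_eq0 addn_eq0; case: a a0.
rewrite -(natr1 a) -(natr1 b) !natrM !natrD !natrM.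
have -> : a%:R + 1 + (b%:R + 1) - 2 = a%:R + b%:R :> R by ring.
by rewrite natrD in ab; field.
Qed.

Theorem theorem1p2 (R : realType) (n m k : nat)
    (hn : (2 <= n)%N) (hm : (2 <= m)%N) (hk : (1 <= k)%N) :
  (forall S1 S2 : {fset R},
     #|` S1| = n -> #|` S2| = m -> 0 \in S1 -> 0 \in S2 ->
     generic (S1 `*` S2) ->
     k%:R * (n%:R - 1) + k%:R / (n%:R + m%:R - 2) * (m%:R - 1) ^+ 2
       <= (cov k (S1 `*` S2))%:R :> R)
  /\
  (forall S1 S2 : {fset R},
     #|` S1| = n -> #|` S2| = m -> 0 \in S1 -> 0 \in S2 ->
     ((n + m - 2) %/ gcdn (n - 1) (m - 1) %| k)%N ->
     (cov k (S1 `*` S2))%:R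
       <= k%:R * (n%:R - 1) + k%:R / (n%:R + m%:R - 2) * (m%:R - 1) ^+ 2 :> R
     /\
     (generic (S1 `*` S2) ->
      (cov k (S1 `*` S2))%:R
        = k%:R * (n%:R - 1) + k%:R / (n%:R + m%:R - 2) * (m%:R - 1) ^+ 2 :> R)).
Proof.
case: n hn => // a a0; case: m hm => // b b0.
have ab0 : 0 < (a + b)%:R :> R by rewrite ltr0n addn_gt0; case: a a0.
rewrite bound_eq //.
have cardD1 (S : {fset R}) c : #|` S| = c.+1 -> 0 \in S -> #|` S `\ 0| = c.
  by move=> cS S0; move: cS; rewrite (cardfsD1 0) S0 => -[].
have lower (S1 S2 : {fset R}) : #|` S1| = a.+1 -> #|` S2| = b.+1 ->
    0 \in S1 -> 0 \in S2 -> generic (S1 `*` S2) ->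
    (k * (a * a + a * b + b * b))%:R / (a + b)%:R <= (cov k (S1 `*` S2))%:R :> R.
  move=> c1 c2 z1 z2 gen; have [H covH <-] := ex_min_cover k (S1 `*` S2).
  have := cover_size_ge z1 z2 gen covH; rewrite (cardD1 _ _ c1 z1) (cardD1 _ _ c2 z2) => le.
  by rewrite ler_pdivrMr // -natrM ler_nat [leqRHS]mulnC.
split=> // S1 S2 c1 c2 z1 z2.
have -> : (a.+1 + b.+1 - 2 = a + b)%N by lia.
rewrite !subn1 /= => /(split_proportionally a0)[v [h [vh ahbv vab]]].
have upper : (cov k (S1 `*` S2))%:R
    <= (k * (a * a + a * b + b * b))%:R / (a + b)%:R :> R.
  have [|H covH sH] := @ex_cover_of_degrees R k v h S1 S2 vh.
    by rewrite (cardD1 _ _ c1 z1) (cardD1 _ _ c2 z2).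
  have hab : (h * (a + b) = k * b)%N by rewrite -vh mulnDr mulnDl mulnC ahbv mulnC.
  rewrite ler_pdivlMr // -natrM ler_nat.
  rewrite (leq_trans (leq_mul (cov_le covH) (leqnn _))) // sH.
  by rewrite (cardD1 _ _ c1 z1) (cardD1 _ _ c2 z2) !mulnDl mulnAC vab (mulnAC h) hab -(mulnA a) hab; lia.
by split=> // gen; apply/le_anti; rewrite upper lower.
Qed.
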